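(* Let $\beta>0$ and let $m,n\to\infty$ with $m n^{-1}\to\beta$. Let $\mathrm{P}^{\star}$ (depending on $m,n$) be a probability distribution on $\{0,1,\dots,n\}$ and let $X$ be a random variable with distribution $\mathrm{P}^{\star}$. Assume that (i) $X$ converges in distribution to a random variable $Z$; (ii) $\mathbf{E} Z^2<\infty$ and $\lim_{m,n\to\infty}\mathbf{E} X^2=\mathbf{E} Z^2$; (iii) $\mathbf{E} Z^3=\infty$. Then the global clustering coefficient of the passive random intersection graph $G^{\star}=G^{\star}(n,m,\mathrm{P}^{\star})$ satisfies $C_{G^{\star}}=1-o_P(1)$.
   Context: Passive random intersection graph $G^{\star}(n,m,\mathrm{P}^{\star})$: vertex set $V=\{v_1,\dots,v_n\}$, auxiliary attribute set $W=\{w_1,\dots,w_m\}$. Each attribute $w\in W$ independently selects a random subset $D_w\subset V$ with $\mathbf{P}(D_w=A)=\mathrm{P}^{\star}(|A|)\binom{n}{|A|}^{-1}$ for $A\subset V$. Two distinct vertices $u,v$ are adjacent iff $u,v\in D_w$ for some $w\in W$. For a graph $G$, the global clustering coefficient is $C_G=3\Delta/\Lambda$, where $\Delta$ is the number of triangles and $\Lambda$ the number of paths of length $2$ in $G$. $o_P(1)$ denotes a quantity converging to $0$ in probability. *)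

(* Defs.v *)
From HB Require Import structures.
From mathcomp Require Import all_boot all_order all_algebra.
From mathcomp Require Import all_classical all_reals all_analysis.
Set Implicit Arguments. Unset Strict Implicit. Unset Printing Implicit Defensive.
Import Order.TTheory GRing.Theory Num.Theory.
Local Open Scope ring_scope.

(* A realisation of the passive random intersection graph G^star(n,m,P^star):
   D w = the random subset D_w of the vertex set V = 'I_n chosen by attribute w. *)
Definition config (n m : nat) := {ffun 'I_m -> {set 'I_n}}.

Definition adj (n m : nat) (D : config n m) (u v : 'I_n) : bool :=
  (u != v) && [exists w : 'I_m, (u \in D w) && (v \in D w)].

Definition ntriangles (n m : nat) (D : config n m) : nat :=
  #|[set T : {set 'I_n} | (#|T| == 3) &&
      [forall u in T, forall v in T, (u != v) ==> adj D u v]]|.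

(* number of paths of length 2: a middle vertex v with an unordered pair of
   distinct neighbours *)
Definition npaths2 (n m : nat) (D : config n m) : nat :=
  \sum_(v : 'I_n) 'C(#|[set u | adj D v u]|, 2).

(* global clustering coefficient C_G = 3 Delta / Lambda (= 0 when Lambda = 0,
   by the MathComp convention 0^-1 = 0) *)
Definition clustering {R : realType} (n m : nat) (D : config n m) : R :=
  3 * (ntriangles D)%:R / (npaths2 D)%:R.

(* probability of a configuration: the D_w are independent and
   P(D_w = A) = Pstar(|A|) / binom(n, |A|) *)
Definition config_prob {R : realType} (n m : nat) (P : nat -> R) (D : config n m) : R :=
  \prod_(w : 'I_m) (P #|D w| / ('C(n, #|D w|))%:R).

(* Main.v *)
(** Let [Lambda] be the number of 2-paths and [Delta] the number of triangles; in
    ordered triples of vertices, [2 Lambda = 6 Delta + open], where [open] counts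
    the 2-paths whose ends are not adjacent, so [|C - 1| = open / (2 Lambda)].
    The two edges of an open path come from two different attributes, which gives
    [E open <= (m^2 / n) (E X^2)^2 = O(n)].  On the other hand every attribute set
    of size at most [K] consists of pairwise adjacent vertices, so
    [6 Delta >= S - R], where [S] is the sum over the attributes [w] of
    [(X_w)_3 1{X_w <= K}] and [R] counts the triples covered by two attributes.
    Here [E R = O(1/n)] and, by Chebyshev, [S >= m e / 2] with high probability,
    where [e = E (X)_3 1{X <= K}].  Hence [C] is close to 1 as soon as [e] is large,
    and since [E Z^3] is infinite, weak convergence makes [e] as large as we like
    for a suitable fixed [K]. *)
Require Import Defs.
From HB Require Import structures.
From mathcomp Require Import all_boot all_order all_algebra.
From mathcomp Require Import finmap.
From mathcomp Require Import all_classical all_reals all_analysis.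
From mathcomp Require Import measurable_realfun.
From mathcomp Require Import zify ring lra.
Import Order.TTheory GRing.Theory Num.Theory.
Import numFieldNormedType.Exports.
Local Open Scope classical_set_scope.
Local Open Scope ring_scope.

Set Implicit Arguments.
Unset Strict Implicit.
Unset Printing Implicit Defensive.

(** * Open and closed paths *)

Notation triple n := ('I_n * 'I_n * 'I_n)%type.

Definition tset n (p : triple n) : {set 'I_n} := [set p.1.1; p.1.2; p.2]%SET.

Definition tuniq n (p : triple n) : bool := uniq [:: p.1.1; p.1.2; p.2].

Lemma card_tset n (p : triple n) : tuniq p -> #|tset p| = 3.
Proof.
rewrite /tuniq /tset /= !inE negb_or => /andP[/andP[h1 h2] /andP[h3 _]].
by rewrite finset.setUC cardsU1 cards2 !inE negb_or ![p.2 == _]eq_sym h1 h2 h3.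
Qed.

(** Triples are matched with injective 3-tuples. The count serves both the orderings of a triangle
    and the triples inside an attribute set. *)
Lemma card_uniq_triples n (A : {set 'I_n}) :
  #|[set p : triple n | tuniq p && (tset p \subset A)]%SET| = (#|A| ^_ 3)%N.
Proof.
rewrite -card_uniq_tuples.
pose f (p : triple n) := [tuple p.1.1; p.1.2; p.2].
have f_inj : injective f by move=> [[a b] c] [[a' b'] c'] [-> -> ->].
rewrite -(card_imset _ f_inj); apply: eq_card => t; rewrite inE.
apply/imsetP/andP => [[[[a b] c]] | [tA tu]].
  rewrite inE /tuniq /tset => /andP[u s] ->; split => //.
  have sA x : x \in [:: a; b; c] -> x \in A.
    by move=> xp; apply: (fintype.subsetP s); move: xp; rewrite !inE orbA.
  by apply/allP => x /sA.
case: t tA tu => [[|a [|b [|c []]]] //= i] tA tu.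
exists (a, b, c); last exact: val_inj.
rewrite inE /tuniq /= tu; apply/fintype.subsetP => x; rewrite !inE -orbA => xT.
by have /allP /(_ x) : all (mem A) [:: a; b; c] := tA; rewrite !inE; apply.
Qed.

(** The first coordinate is the middle vertex and triples are ordered, so an open 2-path is seen
    twice and a triangle six times. *)
Definition open3 n m (D : config n m) (p : triple n) : bool :=
  [&& adj D p.1.1 p.1.2, adj D p.1.1 p.2, p.1.2 != p.2 & ~~ adj D p.1.2 p.2].

Definition closed3 n m (D : config n m) (p : triple n) : bool :=
  [&& adj D p.1.1 p.1.2, adj D p.1.1 p.2 & adj D p.1.2 p.2].

Lemma adjC n m (D : config n m) u v : adj D u v = adj D v u.
Proof.
rewrite /adj eq_sym; congr (_ && _); apply: eq_existsb => w; exact: andbC.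
Qed.

(** Puts the three adjacencies in the form used by [ntriangles], so that closed triples can be
    grouped by their support [tset p]. *)
Lemma closed3E n m (D : config n m) (p : triple n) :
  closed3 D p = tuniq p &&
    [forall u in tset p, forall v in tset p, (u != v) ==> adj D u v].
Proof.
case: p => [[a b] c]; rewrite /closed3 /tuniq /tset /= !inE.
apply/and3P/andP => [[ab ac bc] | [u]].
  split.
    rewrite negb_or andbT.
    by move: (ab) (ac) (bc); rewrite /adj => /andP[-> _] /andP[-> _] /andP[-> _].
  apply/'forall_implyP => x; rewrite !inE => xT.
  apply/'forall_implyP => y; rewrite !inE => yT.
  apply/implyP => xy.
  move: xT yT xy; rewrite -!orbA.
  by move=> /or3P[] /eqP-> /or3P[] /eqP->; rewrite ?eqxx // adjC.
move=> /'forall_implyP h.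
have {h}h x y : x \in [:: a; b; c] -> y \in [:: a; b; c] -> x != y -> adj D x y.
  move=> xT yT; have /(h x)/'forall_implyP : x \in [set a; b; c]%SET.
    by move: xT; rewrite !inE -orbA.
  move=> /(_ y)/[!inE]; move: yT; rewrite !inE orbA => -> /(_ isT)/implyP; exact.
move: u; rewrite negb_or => /andP[/andP[ab ac] /andP[bc _]].
by split; apply: h; rewrite ?inE ?eqxx ?orbT.
Qed.

Lemma card_closed3 n m (D : config n m) :
  #|[set p | closed3 D p]%SET| = (6 * ntriangles D)%N.
Proof.
rewrite /ntriangles -sum1dep_card.
rewrite (partition_big (@tset n) (mem [set T : {set 'I_n} | (#|T| == 3) &&
      [forall u in T, forall v in T, (u != v) ==> adj D u v]]%SET)) /=; last first.
  by move=> p; rewrite closed3E inE => /andP[/card_tset -> ->].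
rewrite -[RHS]mulnC -sum_nat_const; apply: eq_bigr => T.
rewrite inE => /andP[/eqP T3 cT].
have -> : 6%N = (#|T| ^_ 3)%N by rewrite T3.
rewrite -card_uniq_triples -sum1dep_card.
apply: eq_bigl => p; rewrite closed3E.
apply/andP/andP => [[/andP[-> _] /eqP->] // | [up sp]].
have /eqP e : tset p == T by rewrite eqEcard sp T3 card_tset.
by rewrite e up cT.
Qed.

(** Both counts together run over the ordered pairs of distinct neighbours of a middle vertex; a
    vertex of degree [d] has [d ^_ 2 = 2 * 'C(d, 2)] of them. *)
Lemma card_open_closed3 n m (D : config n m) :
  (#|[set p | open3 D p]%SET| + #|[set p | closed3 D p]%SET| = 2 * npaths2 D)%N.
Proof.
rewrite /npaths2 big_distrr /=.
transitivity #|[set p : triple n |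
   [&& adj D p.1.1 p.1.2, adj D p.1.1 p.2 & p.1.2 != p.2]]%SET|.
  rewrite -cardsUI [X in (_ + X)%N](_ : _ = 0)%N ?addn0.
    apply: eq_card => -[[a b] c]; rewrite !inE /open3 /closed3 /=.
    case: (adj D a b) => //; case: (adj D a c) => //=.
    case: (boolP (adj D b c)) => [|_]; last by rewrite andbT orbF.
    by rewrite /adj andbF => /andP[->].
  apply: eq_card0 => p; rewrite !inE /open3 /closed3.
  by case: (adj D p.1.2 p.2); rewrite !andbF.
rewrite -sum1dep_card (partition_big (fun p => p.1.1) predT) //=.
apply: eq_bigr => v _.
set N := [set u | adj D v u]%SET.
have -> : (2 * 'C(#|N|, 2) = #|N| ^_ 2)%N by rewrite -bin_ffact mulnC.
rewrite -card_uniq_tuples sum1dep_card.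
pose f (t : 2.-tuple 'I_n) : triple n := (v, tnth t ord0, tnth t (inord 1)).
have f_inj : injective f.
  move=> s t [e0 e1]; apply: eq_from_tnth => i.
  have /orP[] : (i == ord0) || (i == inord 1).
    by case: i => [[|[|]]] // ?; rewrite -!val_eqE /= inordK.
  - by move/eqP->.
  - by move/eqP->.
rewrite -(card_imset _ f_inj); apply: eq_card => -[[a b] c]; rewrite !inE /=.
apply/idP/imsetP => [/andP[/and3P[ab ac bc] /eqP va] | [t]].
  subst v; have bN : b \in N by rewrite inE.
  have cN : c \in N by rewrite inE.
  exists [tuple b; c]; last by rewrite /f /= !(tnth_nth a) inordK.
  rewrite inE; apply/andP; split; last by rewrite /= inE bc.
  by apply/allP => x; rewrite !inE => /orP[] /eqP->.
rewrite inE => /andP[/allP tN tu] [-> -> ->].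
have adjN i : adj D v (tnth t i) 
  by have : tnth t i \in N := tN _ (mem_tnth i t); rewrite inE.
rewrite !adjN eqxx andbT /= !(tnth_nth v) inordK //.
by case: t tu {tN adjN} => [[|? [|? []]]] //= i; rewrite !inE andbT.
Qed.

(** * Counting triples through the attributes that cover them *)

Definition hit n m K (D : config n m) (p : triple n) (w : 'I_m) : bool :=
  (#|D w| <= K)%N && (tset p \subset D w).

Definition small_triples n m K (D : config n m) : nat :=
  (\sum_w (#|D w| <= K) * #|D w| ^_ 3)%N.

Definition overlap n m K (D : config n m) : nat :=
  (\sum_(p | tuniq p) \sum_w \sum_(w' | w' != w) hit K D p w * hit K D p w')%N.

Definition forks n m (D : config n m) : nat :=
  (\sum_(p | tuniq p) \sum_w \sum_(w' | w' != w)
     ([set p.1.1; p.1.2]%SET \subset D w) * ([set p.1.1; p.2]%SET \subset D w'))%N.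

Lemma adjP n m (D : config n m) u v :
  reflect (u != v /\ exists w, (u \in D w) /\ (v \in D w)) (adj D u v).
Proof.
apply: (iffP andP) => -[uv].
  by move=> /existsP[w /andP[? ?]]; split=> //; exists w.
by move=> [w [? ?]]; split=> //; apply/existsP; exists w; apply/andP.
Qed.

Lemma small_triplesE n m K (D : config n m) :
  small_triples K D = (\sum_(p | tuniq p) \sum_w hit K D p w)%N.
Proof.
rewrite exchange_big /=; apply: eq_bigr => w _.
rewrite /hit; case: leqP => _ /=; last by rewrite mul0n big1.
rewrite mul1n -card_uniq_triples -sum1dep_card [RHS]big_mkcond [LHS]big_mkcond /=.
by apply: eq_bigr => p _; case: (tuniq p) => //=; case: (_ \subset _).
Qed.

(* A Bonferroni inequality for the number of attributes covering a triple. *)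
Lemma sum_hit_le n m K (D : config n m) (p : triple n) : tuniq p ->
  (\sum_w hit K D p w <=
   closed3 D p + \sum_w \sum_(w' | w' != w) hit K D p w * hit K D p w')%N.
Proof.
move=> up; have [/existsP[w0 h0]|/existsPn h] := boolP [exists w, hit K D p w]; last first.
  by rewrite big1 // => w _; rewrite (negbTE (h w)).
have -> : closed3 D p.
  move: up h0 => /= /[dup] up; rewrite /hit closed3E => -> /andP[_ /fintype.subsetP s].
  apply/'forall_implyP => x /s xw; apply/'forall_implyP => y /s yw.
  by apply/implyP => xy; apply/adjP; split=> //; exists w0.
(* The closed triple pays for [w0]; the pairs [(w0, w')] of the double sum pay for every other
   attribute [w']. *)
rewrite (bigD1 w0) //= h0 leq_add2l [leqRHS](bigD1 w0) //= h0.
by under [X in (_ <= X + _)%N]eq_bigr do rewrite mul1n; exact: leq_addr.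
Qed.

Lemma small_triples_le n m K (D : config n m) :
  (small_triples K D <= 6 * ntriangles D + overlap K D)%N.
Proof.
rewrite small_triplesE -card_closed3 -sum1dep_card.
have -> : (\sum_(p | closed3 D p) 1 = \sum_(p : triple n | tuniq p) closed3 D p)%N.
  rewrite big_mkcond [RHS]big_mkcond; apply: eq_bigr => p _.
  by rewrite closed3E; case: (tuniq p) => //=; case: ifP.
by rewrite -big_split /=; apply: leq_sum => p; exact: sum_hit_le.
Qed.

(* An attribute realising both edges of an open path would close it. *)
Lemma card_open3_le n m (D : config n m) :
  (#|[set p | open3 D p]%SET| <= forks D)%N.
Proof.
rewrite -sum1dep_card /forks big_mkcond [leqRHS]big_mkcond /=.
apply: leq_sum => -[[a b] c] _; case: ifP => //.
move=> /and4P[/= /adjP[ab [w [aw bw]]] /adjP[ac [w' [aw' cw']]] bc nbc].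
have ww' : w' != w.
  apply: contra nbc => /eqP e; apply/adjP; split=> //.
  by exists w; rewrite -{2}e.
rewrite ifT; last by rewrite /tuniq /= !inE negb_or ab ac bc.
rewrite (bigD1 w) //= (bigD1 w') //= !finset.subUset !finset.sub1set.
by rewrite aw bw aw' cw'.
Qed.

(** A deviation above [eps] means [open > eps * 2 Lambda >= eps * 6 Delta], while
    [6 Delta >= small_triples - overlap] and [open <= forks]. *)
Lemma clustering_far (R : realType) n m K (D : config n m) (eps : R) :
  0 < eps -> eps < `|clustering D - 1| ->
  eps * (small_triples K D)%:R <= (forks D)%:R + eps * (overlap K D)%:R.
Proof.
move=> eps0 bad.
have := small_triples_le K D; have := card_open3_le D.
have := card_open_closed3 D; rewrite card_closed3.
move: bad; rewrite /clustering.
move: #|_| (ntriangles D) (npaths2 D) (small_triples K D) (forks D) (overlap K D).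
move=> o t l s f v bad /(congr1 (fun k => k%:R : R)); rewrite natrD !natrM => e.
rewrite -(ler_nat R) => of_; rewrite -(ler_nat R) natrD natrM => sv.
(* Without 2-paths the ratio is 0 by convention, so a deviation is possible; but then there are no
   triangles either, and [s <= v]. *)
have [l0|l0] := eqVneq (l%:R : R) 0.
  have o0 : 0 <= o%:R :> R by [].
  have t0 : 0 <= t%:R :> R by [].
  have : s%:R <= v%:R :> R by lra.
  rewrite -(ler_pM2l eps0); have : 0 <= f%:R :> R by []. lra.
have lp : 0 < l%:R :> R by rewrite lt0r l0 ler0n.
have e2 : 3 * t%:R / l%:R - 1 = - (o%:R / (2 * l%:R)) :> R.
  have -> : o%:R = 2 * l%:R - 6 * t%:R :> R by lra.
  by field.
move: bad; rewrite e2 normrN ger0_norm ?divr_ge0 // ?mulr_ge0 //.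
rewrite ltr_pdivlMr; last by lra.
move=> bad; have := ler_wpM2l (ltW eps0) sv.
have : 0 <= eps * o%:R by rewrite mulr_ge0 // ltW.
have : eps * o%:R = eps * (2 * l%:R) - eps * (6 * t%:R) by rewrite -e; ring.
lra.
Qed.

(** * Independent attributes *)

Definition setprob {R : realType} n (P : nat -> R) (A : {set 'I_n}) : R :=
  P #|A| / 'C(n, #|A|)%:R.

Lemma card_supersets n (T : {set 'I_n}) j :
  (#|[set A : {set 'I_n} | (T \subset A) && (#|A| == j)]%SET| * n ^_ #|T|
   = 'C(n, j) * j ^_ #|T|)%N.
Proof.
have Tn : (#|T| <= n)%N by rewrite -[n in leqRHS]card_ord max_card.
have [jT|Tj] := ltnP j #|T|.
  rewrite (ffact_small jT) muln0 eq_card0 // => A; rewrite !inE.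
  by apply/negP => /andP[/subset_leq_card + /eqP e]; rewrite e leqNgt jT.
have [nj|jn] := ltnP n j.
  rewrite (bin_small nj) mul0n eq_card0 // => A; rewrite !inE.
  apply/negP => /andP[_ /eqP e].
  by move: (max_card (mem A)); rewrite e card_ord leqNgt nj.
(* Such a set is [T] together with [j - #|T|] elements of its complement. *)
have -> : #|[set A : {set 'I_n} | (T \subset A) && (#|A| == j)]%SET|
    = 'C(n - #|T|, j - #|T|).
  have <- : #|~: T|%SET = (n - #|T|)%N by rewrite cardsCs finset.setCK card_ord.
  rewrite -cards_draws.
  set S := [set B : {set 'I_n} | (B \subset ~: T) & (#|B| == j - #|T|)%N]%SET.
  have TS (B : {set 'I_n}) : B \in S -> (T :&: B = finset.set0)%SET.
    rewrite inE => /andP[BT _]; apply/eqP.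
    by rewrite finset.setI_eq0 disjoint_sym finset.disjoints_subset.
  have finj : {in S &, injective (finset.setU T)}.
    move=> B B' /TS TB /TS TB' /(congr1 (fun X => X :\: T)%SET).
    rewrite !finset.setDUl finset.setDv !finset.set0U.
    by rewrite !(finset.setDidPl _) // -finset.setI_eq0 finset.setIC ?TB ?TB'.
  rewrite -(card_in_imset finj); apply: eq_card => A; rewrite inE.
  apply/andP/imsetP => [[TA /eqP Aj]|[B BS ->]].
    exists (A :\: T)%SET.
      by rewrite inE finset.subDset finset.setUCr finset.subsetT /= cardsD (finset.setIidPr TA) Aj.
    by rewrite -{1}(finset.setIidPr TA) finset.setID.
  rewrite finset.subsetUl cardsU TS // finset.cards0 subn0.
  by move: BS; rewrite inE => /andP[_ /eqP->]; rewrite subnKC.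
(* After multiplication by [(j - #|T|)! (n - j)!] both sides equal [n!]. *)
apply/eqP; rewrite -(eqn_pmul2r (fact_gt0 (j - #|T|))) -(eqn_pmul2r (fact_gt0 (n - j))).
have e1 : ('C(n - #|T|, j - #|T|) * ((j - #|T|)`! * (n - j)`!) = (n - #|T|)`!)%N.
  by rewrite -(bin_fact (leq_sub2r #|T| jn)) subnBA // subnK.
rewrite mulnAC -mulnA [X in _ == X]mulnAC -[X in _ == X]mulnA.
rewrite -[X in _ == X]mulnA (mulnC (n - j)`! _) -mulnA.
by rewrite mulnCA e1 ffact_fact // (mulnA (j ^_ _)) ffact_fact // bin_fact.
Qed.

(** Given its size [j] the random set is uniform, so it contains [T] with probability
    [j ^_ #|T| / n ^_ #|T|]. The weight [h] leaves room for a truncation of the size. *)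
Lemma sum_setprob_superset (R : realType) n (P h : nat -> R) (T : {set 'I_n}) :
  \sum_(A : {set 'I_n} | T \subset A) setprob P A * h #|A| =
  (\sum_(j < n.+1) P j * h j * (j ^_ #|T|)%:R) / (n ^_ #|T|)%:R.
Proof.
have nT0 : (n ^_ #|T|)%:R != 0 :> R.
  by rewrite pnatr_eq0 -lt0n ffact_gt0 -[n in leqRHS]card_ord max_card.
have ltA (A : {set 'I_n}) : (#|A| < n.+1)%N.
  by rewrite ltnS -[n in leqRHS]card_ord max_card.
rewrite (partition_big (fun A : {set 'I_n} => Ordinal (ltA A)) predT) //=.
rewrite mulr_suml; apply: eq_bigr => j _.
transitivity (\sum_(A : {set 'I_n} | (T \subset A) && (#|A| == j)) (P j / 'C(n, j)%:R * h j)).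
  by apply: eq_big => [A|A /andP[_ /eqP <-]].
rewrite sumr_const -[_ *+ _]mulr_natl.
rewrite (_ : #|_| = #|[set A : {set 'I_n} | (T \subset A) && (#|A| == j)]%SET|); last first.
  by rewrite cardsE.
have jn : ('C(n, j))%:R != 0 :> R by rewrite pnatr_eq0 -lt0n bin_gt0 -ltnS.
have := congr1 (fun k => k%:R : R) (card_supersets T j); rewrite !natrM => e.
apply: (mulIf nT0); rewrite mulrAC e.
by field; rewrite jn nT0.
Qed.

Lemma sum_setprob (R : realType) n (P h : nat -> R) :
  \sum_(A : {set 'I_n}) setprob P A * h #|A| = \sum_(j < n.+1) P j * h j.
Proof.
have := sum_setprob_superset P h (finset.set0 : {set 'I_n}).
rewrite finset.cards0 ffactn0 divr1 => e.
transitivity (\sum_(j < n.+1) P j * h j * (j ^_ 0)%:R).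
  rewrite -e; apply: eq_bigl => A; exact/esym/finset.sub0set.
by apply: eq_bigr => j _; rewrite ffactn0 mulr1.
Qed.

Definition expect {R : realType} n m (P : nat -> R) (f : config n m -> R) : R :=
  \sum_D config_prob P D * f D.

(** Independence is distributivity of a product over sums. Setting all but one or two factors to 1
    yields [expect1] and [expect2]. *)
Lemma expect_prod (R : realType) n m (P : nat -> R) (g : 'I_m -> {set 'I_n} -> R) :
  expect P (fun D => \prod_w g w (D w)) = \prod_w \sum_A setprob P A * g w A.
Proof.
by rewrite bigA_distr_bigA; apply: eq_bigr => D _; rewrite -big_split.
Qed.

Lemma sum_setprob1 (R : realType) n (P : nat -> R) :
  \sum_(j < n.+1) P j = 1 -> \sum_(A : {set 'I_n}) setprob P A = 1.
Proof.
move=> <-; have := sum_setprob n P (fun=> 1).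
by rewrite -!mulr_suml !mulr1.
Qed.

Lemma expect1 (R : realType) n m (P : nat -> R) (g : {set 'I_n} -> R) (w : 'I_m) :
  \sum_(j < n.+1) P j = 1 ->
  expect P (fun D => g (D w)) = \sum_A setprob P A * g A.
Proof.
move=> P1; pose G w' A := if w' == w then g A else 1.
have := expect_prod P G; rewrite [RHS](bigD1 w) //= [X in _ * X]big1 ?mulr1; last first.
  move=> w' /negbTE ww'; rewrite /G ww'; apply: etrans (sum_setprob1 P1).
  by apply: eq_bigr => A _; rewrite mulr1.
rewrite /G eqxx => <-; apply: eq_bigr => D _.
by rewrite (bigD1 w) //= eqxx big1 ?mulr1 // => w' /negbTE ->.
Qed.

Lemma expect2 (R : realType) n m (P : nat -> R) (g h : {set 'I_n} -> R) (w w' : 'I_m) :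
  \sum_(j < n.+1) P j = 1 -> w' != w ->
  expect P (fun D => g (D w) * h (D w')) =
  (\sum_A setprob P A * g A) * (\sum_A setprob P A * h A).
Proof.
move=> P1 ww'; pose G v A := if v == w then g A else if v == w' then h A else 1.
have := expect_prod P G; rewrite [RHS](bigD1 w) //= [X in _ * X](bigD1 w') //=.
rewrite [X in _ * (_ * X)]big1 ?mulr1; last first.
  move=> v /andP[/negbTE vw /negbTE vw']; rewrite /G vw vw'; apply: etrans (sum_setprob1 P1).
  by apply: eq_bigr => A _; rewrite mulr1.
rewrite /G eqxx (negbTE ww') eqxx => <-; apply: eq_bigr => D _.
rewrite (bigD1 w) //= eqxx (bigD1 w') //= (negbTE ww') eqxx big1 ?mulr1 //.
by move=> v /andP[/negbTE -> /negbTE ->].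
Qed.

Lemma expectD (R : realType) n m (P : nat -> R) (f g : config n m -> R) :
  expect P (fun D => f D + g D) = expect P f + expect P g.
Proof. by rewrite /expect -big_split /=; apply: eq_bigr => D _; rewrite mulrDr. Qed.

Lemma expectZ (R : realType) n m (P : nat -> R) (c : R) (f : config n m -> R) :
  expect P (fun D => c * f D) = c * expect P f.
Proof. by rewrite /expect mulr_sumr; apply: eq_bigr => D _; rewrite mulrCA. Qed.

Lemma expect_sum (R : realType) n m (P : nat -> R) (I : finType) (S : pred I)
    (f : I -> config n m -> R) :
  expect P (fun D => \sum_(i | S i) f i D) = \sum_(i | S i) expect P (f i).
Proof.
by rewrite /expect exchange_big /=; apply: eq_bigr => D _; rewrite mulr_sumr.
Qed.

Lemma config_prob_ge0 (R : realType) n m (P : nat -> R) (D : config n m) :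
  (forall j, 0 <= P j) -> 0 <= config_prob P D.
Proof. by move=> P0; apply: prodr_ge0 => w _; rewrite divr_ge0. Qed.

(** * Moment bounds and the tail of the clustering coefficient *)

Lemma markov_expect (R : realType) n m (P : nat -> R) (B : pred (config n m))
    (f : config n m -> R) :
  (forall j, 0 <= P j) -> (forall D, 0 <= f D) -> (forall D, B D -> 1 <= f D) ->
  \sum_(D | B D) config_prob P D <= expect P f.
Proof.
move=> P0 f0 f1; rewrite /expect [leRHS](bigID B) /= -[leLHS]addr0.
apply: lerD; last by apply: sumr_ge0 => D _; rewrite mulr_ge0 // config_prob_ge0.
by apply: ler_sum => D /f1; apply: ler_peMr; rewrite config_prob_ge0.
Qed.

Lemma sum_tuniq (R : realType) n (c : R) :
  \sum_(p : triple n | tuniq p) c = (n ^_ 3)%:R * c.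
Proof.
rewrite sumr_const -[LHS]mulr_natl; congr (_%:R * _).
have := card_uniq_triples [set: 'I_n]%SET; rewrite cardsT card_ord => <-.
by rewrite cardsE; apply: eq_card => p; rewrite [RHS]unfold_in finset.subsetT andbT.
Qed.

(** Common first-moment bound for [forks] and [overlap]: by independence each pair of distinct
    attributes contributes [q ^+ 2] to each triple. *)
Lemma expect_pairs_le (R : realType) n m (P : nat -> R)
    (g h : triple n -> {set 'I_n} -> R) (q : R) :
  \sum_(j < n.+1) P j = 1 ->
  (forall p, tuniq p -> \sum_A setprob P A * g p A = q) ->
  (forall p, tuniq p -> \sum_A setprob P A * h p A = q) ->
  expect P (fun D : config n m =>
    \sum_(p | tuniq p) \sum_w \sum_(w' | w' != w) g p (D w) * h p (D w'))
  <= (n ^_ 3)%:R * (m%:R ^+ 2 * q ^+ 2).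
Proof.
move=> P1 gq hq; rewrite expect_sum -sum_tuniq; apply: ler_sum => p up.
rewrite expect_sum.
apply: (@le_trans _ _ (\sum_(w < m) \sum_(w' < m) q ^+ 2)).
  apply: ler_sum => w _; rewrite expect_sum big_mkcond /=.
  (* The diagonal is filled in with the nonnegative [q ^+ 2], so that the number of pairs becomes
     [m ^ 2]. *)
  apply: ler_sum => w' _; case: ifP => ww'; last exact: sqr_ge0.
  by rewrite (expect2 _ _ P1 ww') gq // hq // -expr2.
rewrite !sumr_const !card_ord -mulrnA -[_ *+ (m * m)]mulr_natl natrM; lra.
Qed.

Lemma sum_setprob_indic (R : realType) n (P h : nat -> R) (T : {set 'I_n}) :
  \sum_A setprob P A * (h #|A| * (T \subset A)%:R) =
  (\sum_(j < n.+1) P j * h j * (j ^_ #|T|)%:R) / (n ^_ #|T|)%:R.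
Proof.
rewrite -sum_setprob_superset [RHS]big_mkcond /=; apply: eq_bigr => A _.
by case: (_ \subset _); rewrite ?mulr1 ?mulr0.
Qed.

Lemma natr_ffact3 (R : realType) (n : nat) : (2 < n)%N ->
  (n ^_ 3)%:R = n%:R * (n%:R - 1) * (n%:R - 2) :> R.
Proof.
move=> n2; have n1 : (0 < n)%N by lia.
have n1' : (1 + 1 <= n)%N by lia.
rewrite !ffactnS ffactn0 muln1 !natrM -!subn1 -subnDA !natrB //.
by rewrite mulrA.
Qed.

(** Two given vertices lie in a given attribute set with probability [E (X)_2 / (n (n - 1))], and
    [(X)_2 <= X ^ 2]. *)
Lemma expect_forks (R : realType) n m (P : nat -> R) :
  (2 < n)%N -> (forall j, 0 <= P j) -> \sum_(j < n.+1) P j = 1 ->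
  expect P (fun D : config n m => (forks D)%:R)
  <= m%:R ^+ 2 * (\sum_(j < n.+1) j%:R ^+ 2 * P j) ^+ 2 / n%:R.
Proof.
move=> n2 P0 P1; set s := \sum_(j < _) _.
set M := \sum_(j < n.+1) P j * 1 * (j ^_ 2)%:R.
have Ms : M <= s.
  apply: ler_sum => j _; rewrite mulr1 [leRHS]mulrC; apply: ler_wpM2l => //.
  by rewrite -natrX ler_nat ffactnS ffactn1 -mulnn leq_mul2l leq_pred orbT.
have M0 : 0 <= M by apply: sumr_ge0 => j _; rewrite mulr_ge0 // mulr1.
pose g (a : triple n -> 'I_n) (p : triple n) (A : {set 'I_n}) : R :=
  1 * ([set p.1.1; a p]%SET \subset A)%:R.
have gq a : (forall p, tuniq p -> p.1.1 != a p) ->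
    forall p, tuniq p -> \sum_A setprob P A * g a p A = M / (n ^_ 2)%:R.
  move=> ha p /ha pa; rewrite /g (sum_setprob_indic P (fun=> 1)).
  by rewrite cards2 pa.
have := @expect_pairs_le R n m P (g (fun p => p.1.2)) (g (fun p => p.2)) _ P1
  (gq _ _) (gq _ _).
rewrite (_ : (fun D : config n m => _) = (fun D : config n m => (forks D)%:R)); last first.
  apply/funext => D; rewrite /forks natr_sum; apply: eq_bigr => p _.
  rewrite natr_sum; apply: eq_bigr => w _; rewrite natr_sum; apply: eq_bigr => w' _.
  by rewrite natrM /g !mul1r.
move=> /(_ _ _)/le_trans; apply.
- by move=> p; rewrite /tuniq /= !inE negb_or => /andP[/andP[]].
- by move=> p; rewrite /tuniq /= !inE negb_or => /andP[/andP[]].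
have n0 : 0 < n%:R :> R by rewrite ltr0n; lia.
have n1 : 0 < n%:R - 1 :> R by rewrite subr_gt0 ltr1n; lia.
have n2' : 0 < n%:R - 2 :> R by rewrite subr_gt0 ltr_nat.
have -> : (n ^_ 2)%:R = n%:R * (n%:R - 1) :> R.
  by rewrite ffactnS ffactn1 natrM -subn1 natrB //; lia.
rewrite natr_ffact3 //.
(* The leftover factor [(n - 2) / (n - 1)] is at most 1. *)
rewrite (_ : _ * _ = (n%:R - 2) / (n%:R - 1) * (m%:R ^+ 2 * M ^+ 2 / n%:R)); last first.
  by field; rewrite !gt_eqF.
apply: (@le_trans _ _ (m%:R ^+ 2 * M ^+ 2 / n%:R)).
  apply: ler_piMl; first by rewrite !mulr_ge0 ?invr_ge0 ?sqr_ge0 // ltW.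
  by rewrite ler_pdivrMr // mul1r lerD2l lerN2 ler1n.
rewrite ler_pM2r ?invr_gt0 // ler_wpM2l ?sqr_ge0 //.
by rewrite ler_sqr // nnegrE // (le_trans M0).
Qed.

Definition trunc_moment3 {R : realType} n (P : nat -> R) K : R :=
  \sum_(j < n.+1) P j * ((j <= K)%N * j ^_ 3)%:R.

Lemma expect_overlap (R : realType) n m K (P : nat -> R) :
  (2 < n)%N -> \sum_(j < n.+1) P j = 1 ->
  expect P (fun D : config n m => (overlap K D)%:R)
  <= m%:R ^+ 2 * trunc_moment3 n P K ^+ 2 / (n ^_ 3)%:R.
Proof.
move=> n2 P1; set e := trunc_moment3 _ _ _.
pose g (p : triple n) (A : {set 'I_n}) : R := (#|A| <= K)%N%:R * (tset p \subset A)%:R.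
have gq p : tuniq p -> \sum_A setprob P A * g p A = e / (n ^_ 3)%:R.
  move=> up; rewrite /g (sum_setprob_indic P (fun k => (k <= K)%N%:R)) card_tset //.
  by congr (_ / _); apply: eq_bigr => j _; rewrite natrM mulrA.
have := @expect_pairs_le R n m P g g _ P1 gq gq.
rewrite (_ : (fun D : config n m => _) = (fun D : config n m => (overlap K D)%:R)); last first.
  apply/funext => D; rewrite /overlap natr_sum; apply: eq_bigr => p _.
  rewrite natr_sum; apply: eq_bigr => w _; rewrite natr_sum; apply: eq_bigr => w' _.
  by rewrite natrM /g /hit -!natrM !mulnb.
move/le_trans; apply.
have n0 : (n ^_ 3)%:R != 0 :> R by rewrite pnatr_eq0 -lt0n ffact_gt0.
by rewrite le_eqVlt; apply/orP; left; apply/eqP; field.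
Qed.

(** The deviation is a sum of independent centred terms, so cross terms vanish. Each variance is at
    most the second moment, which is at most [K ^ 3] times the mean since every term of
    [small_triples] is at most [K ^ 3]. *)
Lemma expect_sub_sqr (R : realType) n m K (P : nat -> R) :
  (forall j, 0 <= P j) -> \sum_(j < n.+1) P j = 1 ->
  expect P (fun D : config n m =>
    ((small_triples K D)%:R - m%:R * trunc_moment3 n P K) ^+ 2)
  <= m%:R * (K%:R ^+ 3 * trunc_moment3 n P K).
Proof.
move=> P0 P1; set e := trunc_moment3 _ _ _.
pose x k : R := ((k <= K)%N * k ^_ 3)%:R.
pose g (A : {set 'I_n}) := x #|A| - e.
have x0 : \sum_(A : {set 'I_n}) setprob P A * x #|A| = e by rewrite sum_setprob.
have g0 : \sum_(A : {set 'I_n}) setprob P A * g A = 0.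
  under eq_bigr do rewrite mulrBr.
  by rewrite sumrB x0 -mulr_suml sum_setprob1 // mul1r subrr.
rewrite (_ : (fun D : config n m => _) =
   (fun D : config n m => \sum_w \sum_w' g (D w) * g (D w'))); last first.
  apply/funext => D; under eq_bigr do rewrite -mulr_sumr.
  rewrite -mulr_suml -expr2; congr (_ ^+ 2).
  rewrite /g sumrB sumr_const card_ord -[e *+ m]mulr_natl; congr (_ - _).
  by rewrite /small_triples natr_sum.
rewrite expect_sum mulr_natl -[m in leRHS]card_ord -sumr_const.
apply: ler_sum => w _; rewrite expect_sum (bigD1 w) //= big1 ?addr0; last first.
  by move=> w' ww'; rewrite (expect2 _ _ P1 ww') g0 mul0r.
rewrite (expect1 (fun A => g A * g A)) //.
apply: (@le_trans _ _ (\sum_(A : {set 'I_n}) setprob P A * x #|A| ^+ 2)).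
  have -> : \sum_A setprob P A * (g A * g A) =
      \sum_(A : {set 'I_n}) setprob P A * x #|A| ^+ 2 - e ^+ 2.
    transitivity (\sum_(A : {set 'I_n}) (setprob P A * x #|A| ^+ 2
        - 2 * e * (setprob P A * x #|A|) + e ^+ 2 * setprob P A)).
      by apply: eq_bigr => A _; rewrite /g; ring.
    by rewrite big_split /= sumrB -!mulr_sumr x0 sum_setprob1 //; ring.
  by rewrite lerBlDr lerDl sqr_ge0.
rewrite -x0 mulr_sumr; apply: ler_sum => A _.
rewrite [leRHS]mulrCA; apply: ler_wpM2l; first by rewrite divr_ge0.
rewrite expr2; apply: ler_wpM2r; first exact: ler0n.
rewrite /x -natrX ler_nat; case: (leqP #|A| K) => //= AK.
by rewrite mul1n !ffactnS ffactn0 muln1 !expnS expn0 muln1 !leq_mul //; lia.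
Qed.

(* Chebyshev for [small_triples] gives the first term, Markov for [forks] and
   [overlap] the other two. *)
Lemma clustering_tail (R : realType) n m K (P : nat -> R) (eps : R) :
  (2 < n)%N -> (0 < m)%N ->
  (forall j, 0 <= P j) -> \sum_(j < n.+1) P j = 1 ->
  0 < eps -> 0 < trunc_moment3 n P K ->
  \sum_(D : config n m | eps < `|clustering D - 1|) config_prob P D <=
    4 * K%:R ^+ 3 / (m%:R * trunc_moment3 n P K)
  + 2 * (m%:R / n%:R) * (\sum_(j < n.+1) j%:R ^+ 2 * P j) ^+ 2
      / (eps * trunc_moment3 n P K)
  + 2 * m%:R * trunc_moment3 n P K / (n ^_ 3)%:R.
Proof.
move=> n2 m0 P0 P1 eps0 e0.
have := @expect_sub_sqr R n m K P P0 P1.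
have := @expect_overlap R n m K P n2 P1.
have := @expect_forks R n m P n2 P0 P1.
move: e0; set e := trunc_moment3 _ _ _; set s := \sum_(j < _) _ => e0.
move=> hf ho hs.
have m0' : 0 < m%:R :> R by rewrite ltr0n.
have me0 : 0 < m%:R * e by rewrite mulr_gt0.
(* On the bad event [F >= 1]: if [small_triples < m e / 2] the squared term is at least 1, otherwise
   [clustering_far] makes the other two sum to at least 1. *)
pose F (D : config n m) := 4 / (m%:R * e) ^+ 2 * ((small_triples K D)%:R - m%:R * e) ^+ 2
   + (2 / (eps * (m%:R * e)) * (forks D)%:R + 2 / (m%:R * e) * (overlap K D)%:R).
have c1 : 0 <= 4 / (m%:R * e) ^+ 2 by rewrite divr_ge0 ?sqr_ge0.
have c2 : 0 <= 2 / (eps * (m%:R * e)) by rewrite divr_ge0 ?mulr_ge0 ?ltW.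
have c3 : 0 <= 2 / (m%:R * e) by rewrite divr_ge0 ?mulr_ge0 ?ltW.
apply: (@le_trans _ _ (expect P F)).
  apply: markov_expect => // D.
    by rewrite !addr_ge0 // mulr_ge0 // sqr_ge0.
  move=> /(clustering_far K eps0); rewrite /F.
  have [le_S|lt_S] := lerP (m%:R * e / 2) (small_triples K D)%:R => far.
    apply: ler_wpDl; first by rewrite mulr_ge0 ?sqr_ge0.
    rewrite (_ : _ + _ = (((forks D)%:R + eps * (overlap K D)%:R) * 2) / (eps * (m%:R * e))); last first.
      by field; rewrite !gt_eqF.
    rewrite ler_pdivlMr ?mulr_gt0 // mul1r.
    have := ler_wpM2l (ltW eps0) le_S; lra.
  apply: ler_wpDr; first by rewrite addr_ge0 // mulr_ge0.
  rewrite mulrAC ler_pdivlMr ?exprn_gt0 // mul1r.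
  set S := _%:R in lt_S *; nra.
rewrite /F !expectD !expectZ.
apply: (@le_trans _ _ (4 / (m%:R * e) ^+ 2 * (m%:R * (K%:R ^+ 3 * e))
   + (2 / (eps * (m%:R * e)) * (m%:R ^+ 2 * s ^+ 2 / n%:R)
   + 2 / (m%:R * e) * (m%:R ^+ 2 * e ^+ 2 / (n ^_ 3)%:R)))).
  by rewrite !lerD // ler_wpM2l.
have n0 : (n ^_ 3)%:R != 0 :> R by rewrite pnatr_eq0 -lt0n ffact_gt0.
have nn0 : n%:R != 0 :> R by rewrite pnatr_eq0; lia.
rewrite le_eqVlt; apply/orP; left; apply/eqP; field.
by rewrite n0 nn0 !gt_eqF.
Qed.

(** * Truncated third moments under weak convergence *)

(* Otherwise the whole interval would consist of atoms, which are countably many. *)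
Lemma exists_continuity_point (R : realType) (mu : probability R R) (a b : R) :
  a < b -> exists x, [/\ a < x, x < b & mu [set x] = 0%E].
Proof.
move=> ab; apply: contrapT => no.
pose A k := [set x : R | ((k.+1%:R^-1)%:E <= mu [set x])%E].
(* If infinite, [A k] would contain [k + 2] atoms of mass at least [1 / (k + 1)], of total mass
   above 1. *)
have finA k : finite_set (A k).
  apply: contrapT => /(@infinite_set_fset _ _ k.+2)[B BA sB].
  have mB : measurable [set` B].
    apply: countable_measurable; first exact: measurable_set1.
    by apply: finite_set_countable; exact: finite_fset.
  have := @probability_le1 _ _ _ mu _ mB; apply/negP; rewrite -ltNge.
  have -> : mu [set` B] = (\sum_(x \in [set` B]) mu [set x])%E.
    rewrite -measure_fin_bigcup //; last by move=> i j _ _ [x [-> ->]].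
    congr (mu _); apply/seteqP; split=> [x Bx|x [y By ->]] //; by exists x.
  rewrite fsbig_finite //= set_fsetK.
  apply: (@lt_le_trans _ _ (\sum_(x <- B) (k.+1%:R^-1)%:E)%E).
    rewrite sumEFin big_const_seq count_predT iter_addr_0 lte_fin.
    rewrite -[_ *+ _]mulr_natr ltr_pdivlMl // mulr1 ltr_nat.
    exact: sB.
  rewrite big_seq [leRHS]big_seq; apply: lee_sum => x xB; exact: BA.
have cA : countable (\bigcup_k A k).
  by apply: bigcup_countable => // k _; exact: finite_set_countable.
have /countable_lebesgue_measure0 : countable `]a, b[%classic.
  apply: sub_countable cA; apply: subset_card_le => x /=.
  rewrite in_itv /= => /andP[ax xb].
  have mx0 : mu [set x] != 0%E by apply/eqP => mx0; apply: no; exists x.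
  have mxf : mu [set x] \is a fin_num by exact: fin_num_measure.
  have mx : 0 < fine (mu [set x]).
    by rewrite fine_gt0 // lt0e mx0 measure_ge0 ltey_eq mxf.
  have [k _ /(_ k (leqnn k)) hk] := near_infty_natSinv_lt (PosNum mx).
  by exists k => //; rewrite /A /= -(fineK mxf) lee_fin ltW.
rewrite lebesgue_measure_itv /= lte_fin ab -EFinD => -[] /eqP.
by rewrite subr_eq0 gt_eqF.
Qed.

Lemma sum_ord_swap (R : realType) (n K : nat) (f : nat -> R) :
  \sum_(i < n.+1 | (i <= K)%N) f i = \sum_(i < K.+1 | (i <= n)%N) f i.
Proof.
rewrite (@big_ord_widen_cond _ _ _ n.+1 (n + K).+1 (fun i => (i <= K)%N)) ?ltnS ?leq_addr //.
rewrite (@big_ord_widen_cond _ _ _ K.+1 (n + K).+1 (fun i => (i <= n)%N)) ?ltnS ?leq_addl //.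
by apply: eq_bigl => i; rewrite !ltnS andbC.
Qed.

(** The 27 serves [i <= 2], where the falling factorial vanishes; from [i = 3] on, [11 * i ^_ 3]
    alone suffices. *)
Lemma cube_le_ffact3 (i : nat) : (i.+1 ^ 3 <= 11 * i ^_ 3 + 27)%N.
Proof.
case: i => [|[|[|i]]] //.
by rewrite !ffactnS ffactn0 /= !expnS expn0; nia.
Qed.

Lemma homo_between_nat (R : realType) (y : nat -> R) :
  (forall j, j%:R < y j < j.+1%:R) -> {homo y : i j / (i <= j)%N >-> i <= j}.
Proof.
move=> hy; apply: homo_leq => [x|x z t|j]; [exact: lexx|exact: le_trans|].
have /andP[_ /ltW h1] := hy j; have /andP[/ltW h2 _] := hy j.+1.
exact: le_trans h2.
Qed.

(* The slices cut the line at continuity points [y j] between consecutive integers,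
   so that the mass of slice [i] is the limit of [P (X = i)]. *)
Definition level (R : realType) (y : nat -> R) (i : nat) : set R :=
  if i is j.+1 then [set` `]y j, y j.+1]] else [set` `]-oo, y 0]].

Lemma measurable_level (R : realType) (y : nat -> R) i : measurable (level y i).
Proof. by case: i => [|i]; exact: measurable_itv. Qed.

Lemma trivIset_level (R : realType) (y : nat -> R) :
  {homo y : i j / (i <= j)%N >-> i <= j} -> trivIset setT (level y).
Proof.
move=> y_mono; apply: ltn_trivIset => n m mn; apply/seteqP; split=> // x [].
case: n mn => // n mn; rewrite /level /= => xm.
rewrite in_itv /= => /andP[+ _]; apply/negP; rewrite -leNgt.
apply: (@le_trans _ _ (y m)); last exact: y_mono.
by case: m xm {mn} => [|m]; rewrite /= in_itv //= => /andP[].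
Qed.

Lemma bigcup_level (R : realType) (y : nat -> R) :
  (forall j, j%:R < y j) -> \bigcup_i level y i = setT.
Proof.
move=> y_gt; apply/seteqP; split=> // x _.
have ex : exists j, x <= y j.
  exists (Num.bound `|x|); apply/ltW/(lt_trans _ (y_gt _)).
  by apply: le_lt_trans (ler_norm x) _; exact: archi_boundP (normr_ge0 x).
have [j xj jmin] := ex_minnP ex; exists j => //.
case: j xj jmin => [|j] xj jmin; rewrite /level /= in_itv //= xj andbT.
by rewrite ltNge; apply/negP => /jmin; rewrite ltnn.
Qed.

Definition level_mass (R : realType) (mu : probability R R) (y : nat -> R) i : R :=
  fine (mu (level y i)).

Lemma sum_level_mass (R : realType) (mu : probability R R) (y : nat -> R) j :
  {homo y : i j / (i <= j)%N >-> i <= j} ->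
  \sum_(i < j.+1) level_mass mu y i = fine (mu [set` `]-oo, y j]]).
Proof.
move=> y_mono; elim: j => [|j IH]; first by rewrite big_ord1.
have ml := measurable_level y j.+1.
rewrite big_ord_recr IH /= /level_mass -fineD ?fin_num_measure //.
rewrite -measureU //; first by rewrite /level -itv_bndbnd_setU // bnd_simp y_mono.
apply/seteqP; split=> // x [/=]; rewrite !in_itv /= => xj /andP[].
by rewrite ltNge xj.
Qed.

(** On slice [i] one has [x <= y i < i + 1], so [cube_le_ffact3] bounds the cube there; the constant
    27 is integrated against a total mass of at most 1. *)
Lemma integral_cube_le (R : realType) (mu : probability R R) (y : nat -> R) (A : R) :
  (forall j, j%:R < y j < j.+1%:R) ->
  (forall K, \sum_(i < K.+1) level_mass mu y i * (i ^_ 3)%:R <= A) ->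
  (\int[mu]_x ((x ^+ 3)%:E) <= (11 * A + 27)%:E)%E.
Proof.
move=> hy hA.
have y_mono := homo_between_nat hy.
have y_gt j : j%:R < y j by have /andP[] := hy j.
pose f (x : R) := (x ^+ 3)%:E.
have mf : measurable_fun setT f.
  by apply/measurable_EFinP; apply: measurable_funX.
(* Dropping the negative part only increases the integral. *)
rewrite integralE; apply: (@le_trans _ _ (\int[mu]_x f^\+ x)%E).
  rewrite -[leRHS]adde0 leeD2l // oppe_le0; exact: integral_ge0.
rewrite -(bigcup_level y_gt) ge0_integral_bigcup //; last 3 first.
- exact: measurable_level.
- by rewrite bigcup_level //; exact: measurable_funepos.
- exact: trivIset_level.
have lev i : (\int[mu]_(x in level y i) f^\+ x
    <= (level_mass mu y i * (11 * (i ^_ 3)%:R + 27))%:E)%E.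
  have mi := measurable_level y i.
  apply: (@le_trans _ _ (\int[mu]_(x in level y i) cst (11 * (i ^_ 3)%:R + 27)%:E x)%E).
    apply: ge0_le_integral => //.
    - by apply: measurable_funTS; exact: measurable_funepos.
    - move=> x xi; rewrite funeposE ge_max; apply/andP; split; last first.
        by rewrite lee_fin addr_ge0 // mulr_ge0.
      have xy : x <= i.+1%:R.
        apply: (@le_trans _ _ (y i)); last by have /andP[_ /ltW] := hy i.
        by case: i xi {mi} => [|i]; rewrite /level /= in_itv //= => /andP[].
      apply: (@le_trans _ _ (i.+1%:R ^+ 3)%:E); last first.
        by rewrite lee_fin -natrX -natrM -natrD ler_nat cube_le_ffact3.
      rewrite lee_fin; have [x0|x0] := lerP 0 x; first by rewrite lerXn2r // nnegrE.
      apply: (@le_trans _ _ 0); last exact: exprn_ge0.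
      by rewrite exprS mulr_le0_ge0 ?sqr_ge0 // ltW.
  by rewrite integral_cst // EFinM /level_mass fineK ?fin_num_measure // muleC.
apply: lime_le.
  by apply: is_cvg_nneseries => i _ _; exact: integral_ge0.
(* One nonnegative slice is added so that the range becomes [K.+1], as in [hA]. *)
apply: nearW => K; apply: (@le_trans _ _ (\sum_(0 <= i < K.+1) \int[mu]_(x in level y i) f^\+ x)%E).
  rewrite [leRHS]big_nat_recr //= leeDl //; exact: integral_ge0.
rewrite big_mkord.
apply: (@le_trans _ _ (\sum_(i < K.+1) (level_mass mu y i * (11 * (i ^_ 3)%:R + 27))%:E)%E).
  by apply: lee_sum => i _; exact: lev.
rewrite sumEFin lee_fin.
under eq_bigr do rewrite mulrDr mulrCA.
rewrite big_split /= -mulr_sumr -mulr_suml sum_level_mass //.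
apply: lerD; first by rewrite ler_pM2l ?hA.
rewrite -[leRHS]mul1r ler_wpM2r // -lee_fin fineK ?fin_num_measure //.
exact: probability_le1.
Qed.

(** For fixed [K] the truncated moment is a finite sum and converges to its analogue for the slice
    masses. Were all these limits at most [A], [integral_cube_le] would make the third moment of
    [mu] finite. *)
Lemma trunc_moment3_unbounded (R : realType) (n : nat -> nat)
    (P : nat -> nat -> R) (mu : probability R R) (A : R) :
  (forall x : R, mu [set x] = 0%E ->
     (fun k => \sum_(j < (n k).+1 | (j%:R <= x)) P k j) @ \oo
       --> fine (mu [set` `]-oo, x]])) ->
  (\int[mu]_x ((x ^+ 3)%:E) = +oo)%E ->
  exists K, \forall k \near \oo, A <= trunc_moment3 (n k) (P k) K.
Proof.
move=> cvgF int_oo.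
have /choice[y hy] (j : nat) : exists x : R, j%:R < x < j.+1%:R /\ mu [set x] = 0%E.
  have [|x [jx xj mx]] := @exists_continuity_point R mu j%:R j.+1%:R.
    by rewrite ltr_nat.
  by exists x; rewrite jx xj.
have y_bnd j : j%:R < y j < j.+1%:R by have [] := hy j.
have y_mono := homo_between_nat y_bnd.
(* Extension by zero beyond [n k] gives sums whose range does not depend on [k]. *)
pose p k i := if (i <= n k)%N then P k i else 0.
(* As [y j] lies strictly between [j] and [j + 1], the integers up to [y j] are those up to [j]. *)
have cdfE k j : \sum_(i < (n k).+1 | (i%:R <= y j)) P k i = \sum_(i < j.+1) p k i.
  rewrite [RHS](eq_bigr (fun i : 'I_j.+1 => if (i <= n k)%N then P k i else 0)) //.
  rewrite -big_mkcond /= -sum_ord_swap; apply: eq_bigl => i.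
  have /andP[jy yj] := y_bnd j; apply/idP/idP => [iy|ij].
    by rewrite -ltnS -(ltr_nat R) (le_lt_trans iy).
  by rewrite (le_trans _ (ltW jy)) // ler_nat.
have cvg_cdf j : (fun k => \sum_(i < j.+1) p k i) @ \oo -->
    \sum_(i < j.+1) level_mass mu y i.
  rewrite sum_level_mass //; have := cvgF _ (hy j).2.
  by under eq_fun do rewrite cdfE.
have cvg_p i : p ^~ i @ \oo --> level_mass mu y i.
  case: i => [|i].
    have := cvg_cdf 0%N; rewrite big_ord1.
    by under eq_fun do rewrite big_ord1.
  (* Point masses are differences of consecutive values of the distribution function. *)
  have diff (u : nat -> R) : u i.+1 = \sum_(j < i.+2) u j - \sum_(j < i.+1) u j.
    by rewrite big_ord_recr /= addrAC subrr add0r.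
  rewrite diff (_ : p ^~ i.+1 = fun k => \sum_(j < i.+2) p k j - \sum_(j < i.+1) p k j).
    exact: cvgB.
  by apply/funext => k; exact: diff.
have cvg_sum j : (fun k => \sum_(i < j) p k i * (i ^_ 3)%:R) @ \oo -->
    \sum_(i < j) level_mass mu y i * (i ^_ 3)%:R.
  elim: j => [|j IH].
    by rewrite big_ord0; under eq_fun do rewrite big_ord0; exact: cvg_cst.
  rewrite big_ord_recr; under eq_fun do rewrite big_ord_recr.
  by apply: cvgD => //; apply: cvgMl; exact: cvg_p.
have cvg_trunc K : (fun k => trunc_moment3 (n k) (P k) K) @ \oo -->
    \sum_(i < K.+1) level_mass mu y i * (i ^_ 3)%:R.
  have -> : (fun k => trunc_moment3 (n k) (P k) K) =
            (fun k => \sum_(i < K.+1) p k i * (i ^_ 3)%:R).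
    apply/funext => k; rewrite /trunc_moment3.
    transitivity (\sum_(i < (n k).+1 | (i <= K)%N) P k i * (i ^_ 3)%:R).
      rewrite [RHS]big_mkcond; apply: eq_bigr => i _.
      by case: ifP => _; rewrite ?mul1n // mul0n mulr0.
    rewrite (sum_ord_swap _ _ (fun i => P k i * (i ^_ 3)%:R)) big_mkcond.
    by apply: eq_bigr => i _; rewrite /p; case: ifP => _; rewrite ?mul0r.
  exact: cvg_sum.
apply: contrapT => no.
have bounded K : \sum_(i < K.+1) level_mass mu y i * (i ^_ 3)%:R <= A.
  rewrite leNgt; apply/negP => ltA; apply: no; exists K.
  have := @cvgr_gt _ _ _ _ _ _ (cvg_trunc K) _ ltA.
  by move=> [N _ hN]; exists N => // k /hN /ltW.
by have := integral_cube_le y_bnd bounded; rewrite int_oo.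
Qed.

(** * Choice of the constants and conclusion *)

Lemma trunc_moment3_le (R : realType) n (P : nat -> R) K :
  (forall j, 0 <= P j) -> \sum_(j < n.+1) P j = 1 ->
  trunc_moment3 n P K <= K%:R ^+ 3.
Proof.
move=> P0 P1; apply: (@le_trans _ _ (\sum_(j < n.+1) P j * K%:R ^+ 3)); last first.
  by rewrite -mulr_suml P1 mul1r.
apply: ler_sum => j _.
rewrite ler_wpM2l // -natrX ler_nat; case: (leqP j K) => //= jK.
by rewrite mul1n !ffactnS ffactn0 muln1 !expnS expn0 muln1 !leq_mul //; lia.
Qed.

(** Each term of [clustering_tail] gets a third of [delta]. Here [beta] and [S] are strict upper
    bounds for [m / n] and the second moment, and [K] stands for the cube of the cutoff. *)
Lemma tail_bound_lt (R : realType) (n m : nat) (beta eps delta A S s e K : R) :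
  (2 < n)%N -> (0 < m)%N -> 0 < eps -> 0 < delta -> 0 <= beta -> 0 <= K ->
  m%:R / n%:R < beta -> 0 <= s < S -> 1 <= e <= K ->
  12 * K / delta + 1 <= m%:R -> 12 * beta * K / delta <= n%:R ->
  6 * beta * S ^+ 2 / (eps * delta) <= e ->
  4 * K / (m%:R * e) + 2 * (m%:R / n%:R) * s ^+ 2 / (eps * e)
    + 2 * m%:R * e / (n ^_ 3)%:R < delta.
Proof.
move=> n2 m0 eps0 d0 b0 K0 mn /andP[s0 sS] /andP[e1 eK] hm hn he.
have n0 : 3 <= n%:R :> R by rewrite ler_nat.
have m0' : 0 < m%:R :> R by rewrite ltr0n.
have e0 : 0 < e by lra.
have t1 : 4 * K / (m%:R * e) < delta / 3.
  rewrite ltr_pdivrMr ?mulr_gt0 //.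
  (* The [+ 1] in [hm] makes this strict, hence also the final sum. *)
  have : 12 * K < m%:R * delta by rewrite -ltr_pdivrMr //; lra.
  have : m%:R * delta <= m%:R * delta * e by rewrite ler_peMr // mulr_ge0 ?ltW.
  lra.
have t2 : 2 * (m%:R / n%:R) * s ^+ 2 / (eps * e) <= delta / 3.
  rewrite ler_pdivrMr ?mulr_gt0 //.
  move: he; rewrite ler_pdivrMr ?mulr_gt0 // => he.
  have : m%:R / n%:R * s ^+ 2 <= beta * S ^+ 2.
    apply: ler_pM; rewrite ?sqr_ge0 ?divr_ge0 ?ler0n //; first exact: ltW.
    by rewrite ler_sqr ?nnegrE; lra.
  lra.
have t3 : 2 * m%:R * e / (n ^_ 3)%:R <= delta / 3.
  have n3 : (n ^_ 3)%:R = n%:R * ((n%:R - 1) * (n%:R - 2)) :> R.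
    by rewrite natr_ffact3 // mulrA.
  (* For [n >= 3], [(n - 1) (n - 2) >= n / 2]; a quadratic lower bound is enough because [m] is at
     most of order [n]. *)
  have n32 : n%:R * (n%:R / 2) <= (n ^_ 3)%:R :> R.
    by rewrite n3 ler_wpM2l //; nra.
  have n30 : 0 < n%:R * (n%:R / 2) :> R by rewrite mulr_gt0; lra.
  have n30' : 0 < (n ^_ 3)%:R :> R by exact: lt_le_trans n32.
  rewrite ler_pdivrMr //.
  apply: (@le_trans _ _ (delta / 3 * (n%:R * (n%:R / 2)))); last first.
    by rewrite ler_wpM2l //; lra.
  move: mn hn; rewrite ltr_pdivrMr; last lra.
  rewrite ler_pdivrMr // => mn hn.
  have : m%:R * e <= beta * n%:R * K by apply: ler_pM => //; exact: ltW.
  have : n%:R * (12 * beta * K) <= n%:R * (n%:R * delta) by rewrite ler_wpM2l.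
  lra.
lra.
Qed.

Unset Implicit Arguments.

Theorem theorem2 (R : realType) (beta : R) (n m : nat -> nat)
    (P : nat -> nat -> R) (mu : probability R R) :
  0 < beta ->
  (* m, n -> oo with m / n -> beta *)
  (fun k => (n k)%:R : R) @ \oo --> +oo ->
  (fun k => (m k)%:R : R) @ \oo --> +oo ->
  (fun k => (m k)%:R / (n k)%:R : R) @ \oo --> beta ->
  (* P k is a probability distribution on {0, ..., n k} (law of X = X_k) *)
  (forall k j, 0 <= P k j) ->
  (forall k, \sum_(j < (n k).+1) P k j = 1) ->
  (* (i) X converges in distribution to Z ~ mu *)
  (forall x : R, mu [set x] = 0%E ->
     (fun k => \sum_(j < (n k).+1 | (j%:R <= x)) P k j) @ \oo
       --> fine (mu [set` `]-oo, x]])) ->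
  (* (ii) E Z^2 < oo and E X^2 -> E Z^2 *)
  (exists s : R, (\int[mu]_x ((x ^+ 2)%:E) = s%:E)%E /\
     (fun k => \sum_(j < (n k).+1) (j%:R ^+ 2 * P k j)) @ \oo --> s) ->
  (* (iii) E Z^3 = oo *)
  (\int[mu]_x ((x ^+ 3)%:E) = +oo)%E ->
  (* C_{G*} = 1 - o_P(1): C_{G*} -> 1 in probability *)
  forall eps : R, 0 < eps ->
    (fun k => \sum_(D : config (n k) (m k) | eps < `|clustering D - 1|)
        config_prob (P k) D) @ \oo --> (0 : R).
Proof.
move=> beta0 cn cm cmn P0 P1 cvgF [s [_ cs]] int_oo eps eps0.
apply/cvgr0Pnorm_lt => delta delta0.
(* Any values strictly above the limits would do: they bound the sequences eventually. *)
pose b := beta + 1; pose S := s + 1.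
(* The fraction controls the [forks] term, and the 1 ensures [e >= 1]. *)
pose A := 1 + 6 * b * S ^+ 2 / (eps * delta).
have b0 : 0 <= b by rewrite /b; lra.
have A1 : 1 <= A.
  have ed := ltW (mulr_gt0 eps0 delta0).
  by rewrite /A lerDl divr_ge0 // mulr_ge0 ?sqr_ge0 // mulr_ge0.
(* [K] is fixed before [k], so the thresholds on [m k] and [n k] below are constants. *)
have [K hK] := trunc_moment3_unbounded A cvgF int_oo.
have cn' := (cvgryPge (fun k => (n k)%:R : R)).1 cn.
have cm' := (cvgryPge (fun k => (m k)%:R : R)).1 cm.
have ltsS : s < S by rewrite /S ltrDl.
have hs := @cvgr_lt _ _ _ _ _ _ cs _ ltsS.
near=> k.
have n2 : (2 < n k)%N.
  by rewrite -(ler_nat R); near: k; exact: cn'.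
have m0 : (0 < m k)%N.
  by rewrite -(ler_nat R); near: k; exact: cm'.
have eA : A <= trunc_moment3 (n k) (P k) K by near: k.
have e1 : 1 <= trunc_moment3 (n k) (P k) K by exact: le_trans eA.
rewrite ger0_norm; last by apply: sumr_ge0 => D _; exact: config_prob_ge0.
apply: le_lt_trans (clustering_tail n2 m0 (P0 k) (P1 k) eps0 (lt_le_trans ltr01 e1)) _.
apply: (@tail_bound_lt _ _ _ b _ _ S) => //.
- by near: k; apply: cvgr_lt cmn _ _; rewrite /b; lra.
- apply/andP; split; last by near: k; exact: hs.
  by apply: sumr_ge0 => j _; rewrite mulr_ge0 ?sqr_ge0.
- by rewrite e1 trunc_moment3_le.
- by near: k; exact: cm'.
- by near: k; exact: cn'.
- by apply: le_trans eA; rewrite /A lerDr.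
Unshelve. all: by end_near.
Qed.
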